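(* Let $X$ be a non-empty finite set, let $(\mathcal{W}_X,\diamond)$ be the Cartesian magma generated by $X$ with norm $\|\cdot\|:\mathcal{W}_X\to\mathbb{N}$ given by $\|m\|=n$ when $m\in W_n(X)$, and put $p=|X|$. For $\ell\ge1$ let $$W_\ell=\{m\in\mathcal{W}_X:\|m\|=\ell\}.$$ Then $$|W_\ell|=|X|^{\ell}\,C_{\ell-1}=|X|^{\ell}\,\frac{1}{\ell}\binom{2\ell-2}{\ell-1}=C_{\ell-1}(p).$$
   Context: Here $\mathbb{N}=\{1,2,3,\dots\}$. For a non-empty finite set $X$ define recursively the sets of nested 2-tuples $$W_1(X)=X,\qquad W_n(X)=\bigcup_{q=1}^{n-1}W_q(X)\times W_{n-q}(X)\quad(n>1),\qquad \mathcal{W}_X=\bigcup_{n\ge1}W_n(X).$$ The elements of $X$ are regarded as atoms (no element of $X$ is an ordered pair of elements of $\mathcal{W}_X$), so that the sets $W_n(X)$ are pairwise disjoint. The product $\diamond:\mathcal{W}_X\times\mathcal{W}_X\to\mathcal{W}_X$ is $m_1\diamond m_2=(m_1,m_2)$; the symbol $\diamond$ merely denotes this product. The pair $(\mathcal{W}_X,\diamond)$ is called the Cartesian magma generated by $X$. The Catalan numbers are $C_n=\frac{1}{n+1}\binom{2n}{n}$ for $n\ge0$, and the $p$-Catalan numbers are $C_n(p)=p^{n+1}\frac{1}{n+1}\binom{2n}{n}$. *)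

(* Defs.v *)
From HB Require Import structures.
From mathcomp Require Import all_boot all_order all_algebra finmap.
From mathcomp Require Import all_classical.
Set Implicit Arguments.
Unset Strict Implicit.
Unset Printing Implicit Defensive.
Import Order.TTheory GRing.Theory Num.Theory.
Local Open Scope nat_scope.
Local Open Scope classical_set_scope.

(** The set of all nested 2-tuples over [X].  The constructor [Atom] keeps the
    elements of [X] apart from pairs, and [Diamond m1 m2] is the ordered pair
    [(m1, m2)], i.e. the value of the magma product. *)
Inductive cmagma (X : Type) : Type :=
  | Atom of X
  | Diamond of cmagma X & cmagma X.

Notation "m1 ◇ m2" := (Diamond m1 m2) (at level 40, left associativity).

HB.instance Definition _ (X : Type) := gen_eqMixin (cmagma X).
HB.instance Definition _ (X : Type) := gen_choiceMixin (cmagma X).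

(** The graded pieces W_n(X); the recursion equations [W_1] and [W_gt1] below
    are the defining ones, and [W 0] is empty. *)
Inductive W (X : Type) : nat -> set (cmagma X) :=
  | W_atom (x : X) : W 1 (Atom x)
  | W_pair (n q : nat) (m1 m2 : cmagma X) :
      1 < n -> 1 <= q <= n - 1 -> W q m1 -> W (n - q) m2 -> W n (m1 ◇ m2).

Lemma W_1 (X : Type) : @W X 1 = range (@Atom X).
Proof.
apply/seteqP; split=> [m Wm | _ [x _ <-]]; last exact: W_atom.
by inversion Wm; subst => //; exists x.
Qed.

Lemma W_gt1 (X : Type) (n : nat) : 1 < n ->
  @W X n = \bigcup_(q in [set q | 1 <= q <= n - 1])
             [set m1 ◇ m2 | m1 in @W X q & m2 in @W X (n - q)].
Proof.
move=> n1; apply/seteqP; split=> [m Wm | _ [q hq [m1 W1 [m2 W2 <-]]]].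
  by inversion Wm; subst => //; exists q => //; exists m1 => //; exists m2.
exact: (W_pair n1 hq W1 W2).
Qed.

Lemma W_cover (X : Type) : \bigcup_(n in [set n | 1 <= n]) @W X n = [set: cmagma X].
Proof.
apply/seteqP; split=> // m _; elim: m => [x | m1 [n1 /= h1 W1] m2 [n2 /= h2 W2]].
  by exists 1 => //; exact: W_atom.
exists (n1 + n2) => /=; first by rewrite addn_gt0 h1.
apply: (@W_pair _ _ n1) => //; last by rewrite addKn.
  by rewrite -(addn1 1) leq_add.
by rewrite h1 -addnBA // leq_addr.
Qed.

Lemma W_disjoint (X : Type) (n k : nat) (m : cmagma X) : W n m -> W k m -> n = k.
Proof.
move=> Wn; elim: Wn k => [x k Wk | n0 q m1 m2 n1 /andP[_ hq] _ IH1 _ IH2 k Wk].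
  by inversion Wk.
inversion Wk as [|k' q' a b k1 hq' Wa Wb]; subst.
have /andP[_ {}hq'] := hq'.
have e1 := IH1 _ Wa; have e2 := IH2 _ Wb; subst q'.
rewrite -(subnK (leq_trans hq (leq_subr _ _))) e2 subnK //.
exact: leq_trans hq' (leq_subr _ _).
Qed.

(** The norm of [m] is the [n] with [m] in [W n]; by [W_cover] and [W_disjoint]
    it exists, is unique and positive, so the default value 0 is never used. *)
Definition norm (X : Type) (m : cmagma X) : nat := xget 0 [set n | W n m].

Lemma norm_W (X : Type) (n : nat) (m : cmagma X) : W n m -> norm m = n.
Proof. by move=> Wn; apply: xget_unique => // k Wk; exact: W_disjoint Wk Wn. Qed.

Local Open Scope ring_scope.

Definition catalan (n : nat) : rat := 1 / n.+1%:R * 'C(2 * n, n)%:R.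

Definition pcatalan (p n : nat) : rat :=
  p%:R ^+ n.+1 * (1 / n.+1%:R) * 'C(2 * n, n)%:R.

(* Main.v *)
Require Import Defs.
From mathcomp Require Import all_boot all_order all_algebra finmap.
From mathcomp Require Import all_classical.
From mathcomp Require Import zify ring.
Import GRing.Theory Num.Theory.
Local Open Scope classical_set_scope.
Local Open Scope ring_scope.

(** Splitting a tree at its root gives [|W_(n+2)| = \sum_(i <= n) |W_(i+1)| |W_(n-i+1)|],
    so it suffices that the closed form [C_n] satisfies Segner's recurrence
    [S_n = C_(n+1)] with [S_n = \sum_(i <= n) C_i C_(n-i)].  By the symmetry
    [i <-> n - i], a weight [i] in this sum may be replaced by [n / 2].  Expanding
    [\sum_i (i+1) C_i C_(n+1-i)] with [(i+2) C_(i+1) = (4i+2) C_i] then yields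
    [(n+3)/2 S_(n+1) = C_(n+1) + (2n+2) S_n], which is also satisfied by
    [S_n = C_(n+1)]. *)

Lemma catalan0 : catalan 0 = 1.
Proof. by rewrite /catalan muln0 bin0 divr1 mulr1. Qed.

Lemma catalanS (n : nat) :
  n.+2%:R * catalan n.+1 = (4 * n + 2)%:R * catalan n.
Proof.
(* Absorption is applied twice, to rows [2n+2] and [2n+1]; the symmetry of row [2n+1] joins the two
   identities. *)
have binS : (n.+1 * 'C(2 * n.+1, n.+1) = (4 * n + 2) * 'C(2 * n, n))%N.
  have e1 := mul_bin_diag (2 * n).+2 n.
  have e2 := mul_bin_diag (2 * n).+1 n.
  have e4 : (2 * n.+1 = (2 * n).+2)%N by lia.
  have e5 : ('C((2 * n).+1, n) = 'C((2 * n).+1, n.+1))%N.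
    by rewrite -[LHS]bin_sub; [congr 'C(_, _)|]; lia.
  by move: e1 e2; rewrite e4 /= e5; nia.
have := congr1 (fun k : nat => k%:R : rat) binS.
rewrite !natrM /catalan => e.
have n1 : n.+1%:R != 0 :> rat by rewrite pnatr_eq0.
have n2 : n.+2%:R != 0 :> rat by rewrite pnatr_eq0.
by rewrite mul1r mulVKf // mul1r [RHS]mulrCA -e mulKf.
Qed.

Definition catalan_conv (n : nat) : rat :=
  \sum_(i < n.+1) catalan i * catalan (n - i).

Lemma catalan_conv_weight (n : nat) :
  2 * (\sum_(i < n.+1) i%:R * (catalan i * catalan (n - i)))
  = n%:R * catalan_conv n.
Proof.
rewrite mulr_natl mulr2n {2}(reindex_inj rev_ord_inj) -big_split mulr_sumr.
apply: eq_bigr => i _ /=.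
have lein : (i <= n)%N by rewrite -ltnS.
rewrite subSS subKn // [catalan (n - i) * _]mulrC -mulrDl -natrD.
by rewrite subnKC.
Qed.

Lemma catalan_convS (n : nat) :
  n.+3%:R * catalan_conv n.+1
  = 2 * catalan n.+1 + (4 * n + 4)%:R * catalan_conv n.
Proof.
have wS := catalan_conv_weight n.+1; have w := catalan_conv_weight n.
(* First evaluation of the weighted sum: the term [i = 0] is split off and [catalanS] lowers the
   index in the others. Splitting the weight as [i + 1] gives the second evaluation, [lhs]. *)
have shift : \sum_(i < n.+2) i.+1%:R * (catalan i * catalan (n.+1 - i))
    = catalan n.+1 + \sum_(i < n.+1) (4 * i + 2)%:R * (catalan i * catalan (n - i)).
  rewrite big_ord_recl catalan0 !mul1r subn0; congr (_ + _).
  apply: eq_bigr => i _ /=.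
  by rewrite /bump leq0n add1n subSS mulrA catalanS mulrA.
have lhs : \sum_(i < n.+2) i.+1%:R * (catalan i * catalan (n.+1 - i))
    = \sum_(i < n.+2) i%:R * (catalan i * catalan (n.+1 - i)) + catalan_conv n.+1.
  rewrite -big_split; apply: eq_bigr => i _ /=.
  by rewrite -natr1 mulrDl mul1r.
have rhs : \sum_(i < n.+1) (4 * i + 2)%:R * (catalan i * catalan (n - i))
    = 4 * (\sum_(i < n.+1) i%:R * (catalan i * catalan (n - i))) + 2 * catalan_conv n.
  rewrite !mulr_sumr -big_split; apply: eq_bigr => i _ /=.
  by rewrite natrD natrM mulrDl -mulrA.
rewrite lhs rhs in shift.
(* The part [n.+1] of the factor is what [wS] turns into twice the weighted sum; the identity is
   kept doubled to avoid halves. *)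
have -> : n.+3%:R * catalan_conv n.+1
    = n.+1%:R * catalan_conv n.+1 + 2 * catalan_conv n.+1 by ring.
rewrite -wS -mulrDr shift.
have -> : (4 * n + 4)%:R * catalan_conv n
    = 4 * (n%:R * catalan_conv n) + 4 * catalan_conv n by ring.
by rewrite -w; ring.
Qed.

Lemma catalan_convE (n : nat) : catalan_conv n = catalan n.+1.
Proof.
elim: n => [|n IHn].
  have n2 : 2 != 0 :> rat by [].
  apply: (mulfI n2).
  by rewrite catalanS /catalan_conv big_ord1 catalan0 mulr1.
have n3 : n.+3%:R != 0 :> rat by rewrite pnatr_eq0.
(* Both sides become multiples of [catalan n.+1], with coefficients [2 + (4n + 4)] and
   [4(n + 1) + 2]. *)
apply: (mulfI n3); rewrite catalan_convS IHn catalanS -mulrDl -natrD.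
by congr (_%:R * _); lia.
Qed.

(** The shift [q = i + 1] makes the index range that of [catalan_conv n]. *)
Lemma W_SS (X : Type) (n : nat) :
  @W X n.+2 = \bigcup_(i in `I_n.+1)
                [set m1 ◇ m2 | m1 in @W X i.+1 & m2 in @W X (n - i).+1].
Proof.
rewrite W_gt1 //; apply/seteqP; split=> m [i /= hi hm].
  exists i.-1 => /=; first by lia.
  have -> : (n - i.-1).+1 = (n.+2 - i)%N by lia.
  by rewrite prednK //; lia.
exists i.+1 => /=; first by lia.
by have -> : (n.+2 - i.+1)%N = (n - i).+1 by lia.
Qed.

Lemma finite_W (X : finType) (n : nat) : finite_set (@W X n.+1).
Proof.
elim/ltn_ind: n => -[_|n IHn].
  by rewrite W_1; apply: finite_image; exact: finite_finset.
rewrite W_SS; apply: bigcup_finite; first exact: finite_II.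
by move=> i /= hi; apply: finite_image2; apply: IHn; lia.
Qed.

Definition cardW (X : finType) (n : nat) : nat := #|` fset_set (@W X n)|%fset.

Lemma cardW1 (X : finType) : cardW X 1 = #|X|.
Proof.
rewrite /cardW cardT -(size_map (@Atom X)); apply: perm_size.
apply: uniq_perm => [||m]; first exact: fset_uniq.
  by rewrite map_inj_uniq ?enum_uniq // => x y [].
rewrite in_fset_set; last exact: finite_W.
apply/idP/mapP => [|[x _ ->]]; last by rewrite inE; exact: W_atom.
by rewrite inE W_1 => -[x _ <-]; exists x => //; rewrite mem_enum.
Qed.

(** The union in [W_SS] is disjoint, since the left subtree of the root determines [i], and each of
    its blocks is in bijection with a product. *)
Lemma cardW_SS (X : finType) (n : nat) :
  cardW X n.+2 = (\sum_(i < n.+1) cardW X i.+1 * cardW X (n - i).+1)%N.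
Proof.
pose A i : seq (cmagma X) := fset_set (@W X i.+1).
have memA i m : (m \in A i) = (m \in @W X i.+1).
  by rewrite /A in_fset_set //; exact: finite_W.
(* [L] concatenates the blocks, so its size is the sum; it remains to see that it enumerates
   [W n.+2] without repetition. *)
pose L := [seq m | i <- iota 0 n.+1,
                   m <- [seq m1 ◇ m2 | m1 <- A i, m2 <- A (n - i)%N]].
have -> : (\sum_(i < n.+1) cardW X i.+1 * cardW X (n - i).+1)%N = size L.
  rewrite size_allpairs_dep sumnE big_map -(big_mkord xpredT
    (fun i => cardW X i.+1 * cardW X (n - i).+1)%N) /index_iota subn0.
  by apply: eq_bigr => i _; rewrite size_allpairs.
apply: perm_size; apply: uniq_perm => [||m]; first exact: fset_uniq.
  apply: allpairs_uniq_dep; first exact: iota_uniq.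
    by move=> i _; apply: allpairs_uniq; rewrite ?fset_uniq // => -[a b] [c d] _ _ [-> ->].
  (* A tree in blocks [i] and [j] has a left subtree of grades [i.+1] and [j.+1], which agree by
     [W_disjoint]. *)
  move=> u v /allpairsPdep[i [m [_ mi ->]]] /allpairsPdep[j [m' [_ mj ->]]] /= e.
  move: mi mj; rewrite -{}e.
  move=> /allpairsP[[a b] /= [ai _ ->]] /allpairsP[[c d] /= [cj _ [ac _]]].
  suff -> : i = j by [].
  by move: ai cj; rewrite -ac !memA !inE => ai cj; have [] := W_disjoint ai cj.
rewrite in_fset_set; last exact: finite_W.
apply/idP/allpairsPdep.
  rewrite inE W_SS => -[i /= hi [m1 W1 [m2 W2 <-]]].
  exists i, (m1 ◇ m2); split=> [||//]; first by rewrite (mem_iota 0 n.+1).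
  by apply/allpairsP; exists (m1, m2); split; rewrite ?memA ?inE.
move=> [i [_ [hi /allpairsP[[m1 m2] /= [W1 W2 ->]] ->]]].
move: hi W1 W2; rewrite mem_iota !memA !inE => hi W1 W2.
by rewrite W_SS; exists i => //; exists m1 => //; exists m2.
Qed.

Lemma cardWE (X : finType) (n : nat) :
  (cardW X n.+1)%:R = #|X|%:R ^+ n.+1 * catalan n.
Proof.
elim/ltn_ind: n => -[_|n IHn]; first by rewrite cardW1 catalan0 mulr1.
rewrite cardW_SS -catalan_convE natr_sum mulr_sumr; apply: eq_bigr => i _.
have lein : (i <= n)%N by rewrite -ltnS.
rewrite natrM !IHn; try lia.
(* The leaves are shared between the two subtrees, so the power of [#|X|] factors in every
   summand. *)
have -> : n.+2 = (i.+1 + (n - i).+1)%N by lia.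
by rewrite exprD mulrACA.
Qed.

(** By [W_cover] every tree has a grade, and by [norm_W] that grade is its norm. *)
Lemma set_norm (X : Type) (l : nat) :
  (1 <= l)%N -> [set m : cmagma X | norm m = l] = W l.
Proof.
move=> l1; apply/seteqP; split=> [m /= <-|m]; last exact: norm_W.
have : [set: cmagma X] m by [].
by rewrite -W_cover => -[k _ Wk]; rewrite (norm_W Wk).
Qed.

Theorem proposition2 (X : finType) (hX : (0 < #|X|)%N) (p : nat) (hp : p = #|X|)
    (l : nat) (hl : (1 <= l)%N) :
  let Wl : set (cmagma X) := [set m | norm m = l] in
  finite_set Wl /\
  [/\ (#|` fset_set Wl|%fset)%:R = #|X|%:R ^+ l * catalan (l - 1) :> rat,
      #|X|%:R ^+ l * catalan (l - 1)
        = #|X|%:R ^+ l * (1 / l%:R) * 'C(2 * l - 2, l - 1)%:R :> rat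
    & #|X|%:R ^+ l * (1 / l%:R) * 'C(2 * l - 2, l - 1)%:R
        = pcatalan p (l - 1) :> rat].
Proof.
rewrite /= set_norm //.
(* With [l = n.+1] the truncated differences [l - 1] and [2 * l - 2] are [n] and [2 * n]. *)
case: l hl => // n _.
have e : (2 * n.+1 - 2 = 2 * n)%N by lia.
rewrite e subn1 /=.
split; first exact: finite_W.
split; first exact: cardWE.
- by rewrite /catalan [LHS]mulrA.
- by rewrite /pcatalan hp.
Qed.
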